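(* Let $(\Sigma,\mu)$ be a $\sigma$-finite measure space, $1\le\ell<q<r\le\infty$ and $T>0$. Let $g\in L^1(0,T;L^\ell_\mu\cap L^q_\mu)$ and $u\in L^\infty(0,T;L^\ell_\mu\cap L^r_\mu)$, write $u_0=u(0)$, and suppose that for some $\omega\ge0$, all $0\le s\le t\le T$ and $\lambda\ge0$, $$\|G_\lambda(e^{-\omega t}u(t))\|_\ell\le\|G_\lambda(e^{-\omega s}u(s))\|_\ell+\int_s^te^{-\omega\tau}\|g(\tau)\mathbb{1}_{\{e^{-\omega\tau}|u(\tau)|>\lambda\}}\|_\ell d\tau.$$ Suppose there are increasing functions $c_1,c_2$ on $[0,T]$ with $c_1>0$, $c_2\ge0$, and exponents $\alpha\ge0$, $0<\gamma^*\le\gamma<\infty$ such that for every $t\in(0,T]$ $$\|u(t)\|_r\le\max\Big\{c_1(\tfrac t2)\big(\tfrac2t+\omega\big)^\alpha\big(\|u(\tfrac t2)\|_q+\|g\|_{L^1(\frac t2,t;L^q_\mu)}\big)^\gamma,\ c_2(\tfrac t2)\big(\|u(\tfrac t2)\|_q+\|g\|_{L^1(\frac t2,t;L^q_\mu)}\big)^{\gamma^*}\Big\}.$$ Let $\theta:=1-\gamma\frac{\frac1\ell-\frac1q}{\frac1\ell-\frac1r}$ and suppose $\theta>0$. Then for all $t\in(0,T]$ $$\|u(t)\|_r\le2^\gamma\Big(2^{\frac{\alpha}{\gamma\theta}}+\sup_{s\in(0,t]}N(s)^\theta\Big)^{\frac\gamma\theta}\max\Big\{c_1(t)^{\frac1\theta}\big(\tfrac1t+\omega\big)^{\frac\alpha\theta},c_2(t)^{\frac1\theta}\Big\}\Big(e^{\omega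 t}\|u_0\|_\ell+\int_0^te^{\omega(t-\tau)}\|g(\tau)\|_\ell d\tau\Big)^{\frac{\theta_\ell\gamma}\theta},$$ where $\theta_\ell=\frac{\frac1q-\frac1r}{\frac1\ell-\frac1r}$, $$N(t)=\sup_{s\in(0,t]}\frac{M(\frac s2)\|g\|_{L^1(\frac s2,s;L^q_\mu)}+c_2(\frac s2)^{\frac1\gamma}}{M(s)^{\frac1\theta}\big(e^{\omega s}\|u_0\|_\ell+\int_0^se^{\omega(s-\tau)}\|g(\tau)\|_\ell d\tau\big)^{\frac{\theta_\ell}\theta}},\qquad M(t)=\max\Big\{c_1(t)^{\frac1\gamma}\big(\tfrac1t+\omega\big)^{\frac\alpha\gamma},c_2(t)^{\frac1\gamma}\Big\}.$$
   Context: $L^q_\mu=L^q(\Sigma,\mu)$ with norm $\|\cdot\|_q$; $G_\lambda(s)=[|s|-\lambda]^+\mathrm{sign}(s)$; $1/r=0$ if $r=\infty$. *)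

(* Defs.v *)
From HB Require Import structures.
From mathcomp Require Import all_boot all_order all_algebra.
From mathcomp Require Import all_classical all_reals all_analysis.
Set Implicit Arguments. Unset Strict Implicit. Unset Printing Implicit Defensive.
Import Order.TTheory GRing.Theory Num.Theory.
Import numFieldNormedType.Exports.
Local Open Scope classical_set_scope.
Local Open Scope ring_scope.

Definition Glam {R : realType} (lam s : R) : R :=
  Num.sg s * Num.max (`|s| - lam) 0.

(* 1/r, with the convention 1/r = 0 if r = +oo *)
Definition einv {R : realType} (r : \bar R) : R :=
  match r with
  | x%:E => x^-1
  | _ => 0
  end.

Definition nrm {d} {X : measurableType d} {R : realType}
  (mu : {measure set X -> \bar R}) (p : \bar R) (f : X -> R) : \bar R :=
  Lnorm mu p (EFin \o f).

Definition L1Lp {d} {X : measurableType d} {R : realType}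
  (mu : {measure set X -> \bar R}) (p : \bar R) (g : R -> X -> R) (a b : R)
  : \bar R :=
  (\int[lebesgue_measure]_(tau in `[a, b]%classic) nrm mu p (g tau))%E.

Definition Ebd {d} {X : measurableType d} {R : realType}
  (mu : {measure set X -> \bar R}) (l omega : R) (u0 : X -> R)
  (g : R -> X -> R) (t : R) : \bar R :=
  ((expR (omega * t))%:E * nrm mu l%:E u0 +
   \int[lebesgue_measure]_(tau in `[0%R, t]%classic)
      ((expR (omega * (t - tau)))%:E * nrm mu l%:E (g tau)))%E.

Definition Mfun {R : realType} (c1 c2 : R -> R) (alpha gamma omega t : R) : R :=
  Num.max (powR (c1 t) gamma^-1 * powR (t^-1 + omega) (alpha / gamma))
          (powR (c2 t) gamma^-1).

Definition Nfun {d} {X : measurableType d} {R : realType}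
  (mu : {measure set X -> \bar R}) (l q : R) (c1 c2 : R -> R)
  (alpha gamma omega theta theta_l : R) (u0 : X -> R) (g : R -> X -> R)
  (t : R) : \bar R :=
  ereal_sup [set ((
      (Mfun c1 c2 alpha gamma omega (s / 2))%:E * L1Lp mu q%:E g (s / 2) s
        + (powR (c2 (s / 2)) gamma^-1)%:E)
      / ((powR (Mfun c1 c2 alpha gamma omega s) theta^-1)%:E
         * poweR (Ebd mu l omega u0 g s) (theta_l / theta)))%E
    | s in `]0%R, t]%classic].

(* Main.v *)
Require Import Defs.
From HB Require Import structures.
From mathcomp Require Import all_boot all_order all_algebra.
From mathcomp Require Import all_classical all_reals all_analysis.
From mathcomp Require Import measurable_realfun ess_sup_inf ring lra.
Set Implicit Arguments. Unset Strict Implicit. Unset Printing Implicit Defensive.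
Import Order.TTheory GRing.Theory Num.Theory.
Import numFieldNormedType.Exports.
Local Open Scope classical_set_scope.
Local Open Scope ring_scope.

(** Fix [t] and compare [w(s) = |u(s)|_r^(1/gamma)] with
    [D(s) = M(s)^(1/theta) E(t)^(theta_l/theta)], where [E] is the right-hand side
    of the [L^l] estimate obtained from the truncation estimate at level [0].
    Interpolating [L^q] between [L^l] and [L^r] in the smoothing estimate gives, for
    [y = w/D], the sublinear recursion [y(s) <= K y(s/2)^(1-theta) + n] on [(0,t]]
    with [K = 2^(alpha/(gamma theta))] and [n = N(t)].  If [y] is bounded, then
    [Y = sup y] satisfies [Y <= K Y^(1-theta) + n], hence
    [Y <= (K + n^theta)^(1/theta)], which is the claim (even without [2^gamma]).

    Boundedness of [y] needs a bound on [|u(s)|_q] at every time [s], whereas [u] is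
    only essentially bounded in time.  By the truncation estimate and the absolute
    continuity of the integral of [|g|_l], the weak-type bound
    [|G_lam v|_l^l <= C lam^(l-p)], [q < p <= r], of [v(s) = e^(-omega s) u(s)]
    passes from almost every time to every time, and summing it over dyadic levels
    [lam] bounds the [L^q] norm. *)

(** * Real powers and the halving recursion *)

Lemma powR_le2r (R : realType) (p a b : R) :
  0 <= p -> 0 <= a -> a <= b -> a `^ p <= b `^ p.
Proof.
move=> p0 a0 ab; apply: ge0_ler_powR => //; rewrite nnegrE//.
exact: le_trans ab.
Qed.

Lemma powRK (R : realType) (p a : R) : p != 0 -> 0 <= a -> (a `^ p) `^ p^-1 = a.
Proof. by move=> p0 a0; rewrite -powRrM mulfV// powRr1. Qed.

Lemma powRVK (R : realType) (p a : R) : p != 0 -> 0 <= a -> (a `^ p^-1) `^ p = a.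
Proof. by move=> p0 a0; rewrite -powRrM mulVf// powRr1. Qed.

Lemma powR_split (R : realType) (th a : R) :
  0 <= a -> a `^ th * a `^ (1 - th) = a.
Proof.
by move=> a0; rewrite -powRD ?subrKC ?oner_eq0// powRr1.
Qed.

(** Boundedness makes the supremum [Y] finite, and [Y] inherits the recursion in the form Y <= K
    Y^(1-th) + n. The value of [B] does not enter the result, so a crude bound suffices. *)
Lemma sublinear_halving_bound (R : realType) (K n th t B : R) (y : R -> R) :
  0 < th < 1 -> 0 <= K -> 0 <= n ->
  (forall s, 0 < s <= t -> 0 <= y s <= B) ->
  (forall s, 0 < s <= t -> y s <= K * y (s / 2) `^ (1 - th) + n) ->
  forall s, 0 < s <= t -> y s <= (K + n `^ th) `^ th^-1.
Proof.
move=> /andP[th0 th1] K0 n0 yB yrec s sT.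
pose S := [set y s | s in [set s | 0 < s <= t]].
have supS : has_sup S.
  split; first by exists (y s), s.
  by exists B => _ [z /= zt <-]; have /andP[] := yB z zt.
have yY z : 0 < z <= t -> y z <= sup S.
  by move=> zt; apply: ub_le_sup; [case: supS | exists z].
set Y := sup S in yY *.
apply: le_trans (yY _ sT) _.
have Y0 : 0 <= Y by apply: le_trans (yY _ sT); have /andP[] := yB s sT.
have th1' : 0 <= 1 - th by rewrite subr_ge0 ltW.
have Yrec : Y <= K * Y `^ (1 - th) + n.
  apply: ge_sup; first by case: supS.
  move=> _ [z /= /[dup] zt /andP[z0 zt'] <-].
  have zt2 : 0 < z / 2 <= t by apply/andP; split; lra.
  apply: le_trans (yrec _ zt) _; rewrite lerD2r ler_wpM2l//.
  by apply: powR_le2r => //; [have /andP[] := yB _ zt2 | exact: yY].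
have nth0 := powR_ge0 n th.
(* If Y <= n, monotonicity of powers concludes. Otherwise n = n^th n^(1-th) <= n^th Y^(1-th), and
   the common factor Y^(1-th) cancels. *)
have [Yn|nY] := leP Y n.
  apply: le_trans Yn _; rewrite -[leLHS](@powRK _ th)// ?gt_eqF//.
  by apply: powR_le2r => //; [rewrite invr_ge0 ltW | rewrite lerDr].
have Ygt0 : 0 < Y by exact: le_lt_trans nY.
rewrite -[leLHS](@powRK _ th)// ?gt_eqF//.
apply: powR_le2r; [by rewrite invr_ge0 ltW | exact: powR_ge0 |].
rewrite -(@ler_pM2r _ (Y `^ (1 - th))) ?powR_gt0// powR_split//.
apply: le_trans Yrec _; rewrite mulrDl lerD2l -{1}(@powR_split _ th n)//.
by rewrite ler_wpM2l// powR_le2r// ltW.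
Qed.

(** The scale (M(s) a)^(1/th) is the one for which division of [w] turns the factor M(s/2) a into a
    constant. Comparing the scales at s/2 and s costs kap^(1/th), which becomes the constant of the
    reduced recursion. *)
Lemma scaled_halving_bound (R : realType) (kap n a th t B : R) (M w h : R -> R) :
  0 < th < 1 -> 0 <= kap -> 0 <= n -> 0 < a -> 0 < t ->
  (forall s, 0 < s <= t -> 0 < M s) ->
  (forall s, 0 < s <= t -> M (s / 2) <= kap * M s) ->
  (forall s, 0 < s <= t -> 0 <= w s) ->
  (forall s, 0 < s <= t -> w s <= B * M s `^ th^-1) ->
  (forall s, 0 < s <= t ->
     w s <= M (s / 2) * a * w (s / 2) `^ (1 - th) + h s) ->
  (forall s, 0 < s <= t -> h s <= n * (M s * a) `^ th^-1) ->
  w t <= (kap `^ th^-1 + n `^ th) `^ th^-1 * (M t * a) `^ th^-1.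
Proof.
move=> /[dup] th01 /andP[th0 th1] kap0 n0 a0 t0 M0 Mkap w0 wB wrec hn.
have thV0 : 0 <= th^-1 by rewrite invr_ge0 ltW.
have D0 s : 0 < s <= t -> 0 < (M s * a) `^ th^-1.
  by move=> st; rewrite powR_gt0// mulr_gt0// M0.
rewrite -ler_pdivrMr; last by apply: D0; rewrite t0 lexx.
apply: (@sublinear_halving_bound _ _ n th t (B / a `^ th^-1)
  (fun s => w s / (M s * a) `^ th^-1)) => //; first exact: powR_ge0; last first.
  by rewrite t0 lexx.
- move=> s /[dup] st /andP[s0 st'].
  have st2 : 0 < s / 2 <= t by apply/andP; split; lra.
  rewrite ler_pdivrMr; last exact: D0.
  apply: le_trans (wrec _ st) _.
  rewrite mulrDl; apply: lerD; last exact: hn.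
  set D2 := (M (s / 2) * a) `^ th^-1.
  have D20 : 0 < D2 by exact: D0.
  have Ma0 : 0 <= M (s / 2) * a by rewrite ltW// mulr_gt0// M0.
  (* This holds because D2^th is M(s/2) a, hence D2 = M(s/2) a D2^(1-th). *)
  have -> : M (s / 2) * a * w (s / 2) `^ (1 - th) =
            D2 * (w (s / 2) / D2) `^ (1 - th).
    rewrite powRM; [|exact: w0|by rewrite invr_ge0 ltW].
    rewrite mulrCA mulrC; congr (_ * _).
    rewrite -powR_inv1; last exact: ltW.
    rewrite -(powRrM D2) mulN1r powRN -/D2.
    rewrite -{1}(@powR_split _ th D2); last exact: ltW.
    rewrite mulfK; last by rewrite gt_eqF// powR_gt0.
    by rewrite /D2 powRVK// gt_eqF.
  rewrite [leRHS]mulrAC ler_wpM2r ?powR_ge0//.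
  rewrite -powRM//; last by rewrite ltW// mulr_gt0// M0.
  apply: powR_le2r => //; by rewrite mulrA (ler_wpM2r (ltW a0))// Mkap.
- move=> s st; rewrite divr_ge0 ?w0 ?powR_ge0//=.
  rewrite ler_pdivrMr; last exact: D0.
  apply: le_trans (wB _ st) _.
  rewrite powRM; [|exact/ltW/M0|exact: ltW].
  rewrite -mulrA [X in _ <= _ * X]mulrC mulfK//.
  by rewrite gt_eqF// powR_gt0.
Qed.

(** * Monotonicity of integrals and smallness of their tails *)

(* The lower integral is monotone without any measurability; this matters because
   the integrand of the truncation estimate need not be measurable in time. *)
Lemma ge0_le_integral_subset (d : measure_display) (T : measurableType d)
    (R : realType) (mu : {measure set T -> \bar R}) (D D' : set T)
    (f g : T -> \bar R) :
  (forall x, D x -> (0 <= f x)%E) -> (forall x, D' x -> (0 <= g x)%E) ->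
  D `<=` D' -> (forall x, D x -> (f x <= g x)%E) ->
  (\int[mu]_(x in D) f x <= \int[mu]_(x in D') g x)%E.
Proof.
move=> f0 g0 DD' fg; rewrite !ge0_integralE//.
apply: le_ereal_sup => _ [h /= hf <-]; exists h => // x.
apply: le_trans (hf x) _; rewrite !patchE.
case: ifPn => [/set_mem Dx|_]; last by case: ifPn => // /set_mem /g0.
by rewrite ifT; [exact: fg | exact/mem_set/DD'].
Qed.

(** Monotone convergence along the intervals [0, t - t/(n+1)], whose union omits only the null point
    t, brings their integrals within e of the total. *)
Lemma ge0_integral_tail_le (R : realType) (f : R -> \bar R) (t e : R) :
  0 < t -> 0 < e -> measurable_fun `[0, t]%classic f ->
  (forall x, 0 <= x <= t -> (0 <= f x)%E) ->
  (\int[lebesgue_measure]_(x in `[0%R, t]%classic) f x < +oo)%E ->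
  exists2 s0, 0 <= s0 < t & forall s, s0 < s -> s <= t ->
    (\int[lebesgue_measure]_(x in `[s, t]%classic) f x <= e%:E)%E.
Proof.
move=> t0 e0 mf f0 foo.
pose a n : R := t - t / n.+1%:R.
have a0 n : 0 <= a n.
  by rewrite subr_ge0 ler_pdivrMr// ler_peMr ?ler1n// ltW.
have at_ n : a n < t by rewrite ltrBlDr ltrDl divr_gt0.
pose F n : set R := `[0, a n]%classic.
have subF n : F n `<=` `[0, t]%classic.
  move=> x; rewrite /F /= !in_itv/= => /andP[-> xa].
  by rewrite (le_trans xa)// ltW.
have f0' x : `[0, t]%classic x -> (0 <= f x)%E.
  by rewrite /= in_itv/= => /f0.
have homoF : {homo F : n m / (n <= m)%N >-> (n <= m)%O}.
  move=> n m nm; apply/subsetPset => x; rewrite /F /= !in_itv/= => /andP[-> xa].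
  rewrite (le_trans xa)// lerD2l lerN2 ler_pM2l// lef_pV2 ?posrE//.
  by rewrite ler_nat.
have Fcvg : (\int[lebesgue_measure]_(x in F n) f x)%E @[n --> \oo] -->
    (\int[lebesgue_measure]_(x in \bigcup_n F n) f x)%E.
  apply: ge0_nondecreasing_set_cvg_integral.
  - exact: homoF.
  - by move=> n; exact: measurable_itv.
  - by move=> n; apply: measurable_funS mf => //; exact: measurable_itv.
  - by move=> n x /subF; exact: f0'.
have FE : \bigcup_n F n = `[0, t]%classic `\ t.
  apply/seteqP; split => [x [n _ Fx]|x [/= + /eqP xt]].
    split; first exact: subF Fx.
    move: Fx => /=; rewrite /F /= in_itv/= => /andP[_ xa] xt.
    by have := at_ n; rewrite ltNge -xt xa.
  rewrite in_itv/= => /andP[x0 xt'].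
  have xlt : x < t by rewrite lt_neqAle xt xt'.
  have d0 : 0 < (t - x) / t by rewrite divr_gt0// subr_gt0.
  have [n _ /(_ n (leqnn n))] := near_infty_natSinv_lt (PosNum d0).
  rewrite /= ltr_pdivlMr// mulrC => nP.
  by exists n => //; rewrite /F /= in_itv/= x0/= /a lerBrDr addrC -lerBrDr ltW.
rewrite FE integral_setD1 in Fcvg; last 2 first.
- by apply: measurableD => //; exact: measurable_itv.
- by apply: measurable_funS mf => //; exact: subDsetl.
set I := (\int[lebesgue_measure]_(x in `[0%R, t]%classic) f x)%E in foo Fcvg.
have I0 : (0 <= I)%E by exact: integral_ge0.
have Ifin : I \is a fin_num by rewrite ge0_fin_numE.
have IltF : \forall n \near \oo,
    (I - e%:E <= \int[lebesgue_measure]_(x in F n) f x)%E.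
  have -> : (I - e%:E = (fine I - e)%:E)%E by rewrite EFinB fineK.
  apply: lte_lim.
  - move=> n m nm; apply: ge0_le_integral_subset => //.
    + by move=> x /subF; exact: f0'.
    + by move=> x /subF; exact: f0'.
    + exact/subsetPset/homoF.
  - by apply/cvg_ex; exists I.
  - by rewrite (cvg_lim _ Fcvg)// EFinB fineK// lteBlDr// lteDl// lte_fin.
have [n _ /(_ n (leqnn n)) /= nP] := IltF.
exists (a n); first by rewrite a0 at_.
move=> s ans st.
have sS : (\int[lebesgue_measure]_(x in `[s, t]%classic) f x
        <= \int[lebesgue_measure]_(x in `]a n, t]%classic) f x)%E.
  apply: ge0_le_integral_subset => //.
  - move=> x; rewrite /= in_itv/= => /andP[sx xt]; apply: f0.
    by rewrite xt andbT (le_trans (a0 n))// (le_trans (ltW ans)).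
  - move=> x; rewrite /= in_itv/= => /andP[sx xt]; apply: f0.
    by rewrite xt andbT (le_trans (a0 n))// ltW.
  - by move=> x; rewrite /= !in_itv/= => /andP[sx ->]; rewrite (lt_le_trans ans).
apply: le_trans sS _.
have IE : I = (\int[lebesgue_measure]_(x in F n) f x +
               \int[lebesgue_measure]_(x in `]a n, t]%classic) f x)%E.
  have itvE : `[0, t]%classic = F n `|` `]a n, t]%classic.
    rewrite /F -itv_bndbnd_setU//; first by rewrite bnd_simp.
    by rewrite bnd_simp ltW.
  rewrite /I itvE ge0_integral_setU//.
  - exact: measurable_itv.
  - by rewrite -itvE.
  - by rewrite -itvE.
  - by rewrite disj_set2E; apply/eqP/seteqP; split => // x [/=]; rewrite /F /= !in_itv/=
      => /andP[_ +] /andP[+ _]; lra.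
have F1fin : (\int[lebesgue_measure]_(x in F n) f x)%E \is a fin_num.
  rewrite ge0_fin_numE; last by apply: integral_ge0 => x /subF; exact: f0'.
  apply: le_lt_trans foo; apply: ge0_le_integral_subset => //.
  by move=> x /subF; exact: f0'.
(* Cancelling the integral over [F n] is legitimate in the extended reals because it is finite. *)
have cancel (x y : \bar R) : x \is a fin_num ->
    (x + y - e%:E <= x)%E -> (y <= e%:E)%E.
  by move=> xfin; rewrite leeBlDr// leeD2lE.
by apply: cancel F1fin _; rewrite -IE.
Qed.

(** * Measurability in time and interpolation of norms *)

(** Tonelli's theorem for |g|^p extended by zero outside D x X, followed by the power 1/p. *)
Lemma measurable_fun_nrm (R : realType) (d : measure_display)
    (X : measurableType d) (mu : {measure set X -> \bar R}) (p : R)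
    (D : set R) (g : R -> X -> R) :
  sigma_finite [set: X] mu -> measurable D ->
  measurable_fun (D `*` [set: X]) (fun z : R * X => g z.1 z.2) ->
  measurable_fun D (fun tau => nrm mu p%:E (g tau)).
Proof.
move=> sfmu mD mg.
(* Tonelli's theorem takes a measure bundled as sigma-finite, so [mu] is repackaged as [nu], which
   stays convertible to it. *)
pose H1 := isSFinite.Build _ _ _ mu (sfinite_measure_sigma_finite sfmu).
pose H2 := isSigmaFinite.Build _ _ _ mu sfmu.
pose nu := HB.pack_for (SigmaFiniteMeasure.type X R) (Measure.sort mu) H1 H2.
pose F (z : R * X) : \bar R :=
  ((fun z : R * X => (`|g z.1 z.2| `^ p)%:E) \_ (D `*` [set: X])) z.
have mF : measurable_fun [set: R * X] F.
  have mDT : measurable (D `*` [set: X]) by exact: measurableX.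
  apply/(measurable_restrictT _ mDT).
  apply/measurable_EFinP.
  apply: (measurableT_comp (measurable_powR p)).
  exact: measurableT_comp.
have F0 z : (0 <= F z)%E.
  by rewrite /F patchE; case: ifP => // _; rewrite lee_fin powR_ge0.
have mFF := @measurable_fun_fubini_tonelli_F _ _ R X R nu F mF F0.
have mI : measurable_fun D (fun tau => \int[mu]_x F (tau, x))%E.
  exact: measurable_funTS mFF.
apply: (eq_measurable_fun (fun tau => (\int[mu]_x F (tau, x)) `^ p^-1)%E).
  move=> tau /set_mem Dtau; rewrite /nrm unlock; congr (_ `^ _)%E.
  apply: eq_integral => x _; rewrite /F patchE ifT//.
  by apply/mem_set; split.
exact: (measurableT_comp (measurable_poweR _)).
Qed.

Lemma nrm_ge0 (R : realType) (d : measure_display) (X : measurableType d)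
  (mu : {measure set X -> \bar R}) (p : \bar R) (f : X -> R) :
  (0 <= nrm mu p f)%E.
Proof. exact: Lnorm_ge0. Qed.

Lemma poweR_nrm (R : realType) (d : measure_display) (X : measurableType d)
    (mu : {measure set X -> \bar R}) (p : R) (f : X -> R) : p != 0 ->
  (nrm mu p%:E f `^ p = \int[mu]_x (`|f x| `^ p)%:E)%E.
Proof. by move=> p0; rewrite poweR_Lnorm. Qed.

Lemma poweR_le2r (R : realType) (p : R) (a b : \bar R) :
  0 <= p -> (0 <= a)%E -> (a <= b)%E -> (a `^ p <= b `^ p)%E.
Proof.
move=> p0 a0 ab; apply: gt0_ler_poweR => //; rewrite in_itv/= leey andbT//.
exact: le_trans ab.
Qed.

Lemma poweRK (R : realType) (p : R) (a : \bar R) :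
  p != 0 -> (0 <= a)%E -> ((a `^ p) `^ p^-1 = a)%E.
Proof. by move=> p0 a0; rewrite -poweRrM mulfV// poweRe1. Qed.

Lemma measurable_powR_norm (R : realType) (d : measure_display)
    (X : measurableType d) (f : X -> R) (p : R) :
  measurable_fun [set: X] f -> measurable_fun [set: X] (fun x => `|f x| `^ p).
Proof.
move=> mf; apply: (measurableT_comp (measurable_powR p)).
exact: measurableT_comp.
Qed.

(** Hölder's inequality for |f|^(q tl) and |f|^(q (1-tl)) with exponents l/(q tl) and r/(q (1-tl));
    the relation between l, q and r says that these are conjugate. *)
Lemma nrm_interpolation_fin (R : realType) (d : measure_display)
    (X : measurableType d) (mu : {measure set X -> \bar R}) (l q r tl : R)
    (f : X -> R) :
  measurable_fun [set: X] f -> 0 < l -> 0 < q -> 0 < r -> 0 < tl < 1 ->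
  q^-1 = tl / l + (1 - tl) / r ->
  (nrm mu q%:E f <= nrm mu l%:E f `^ tl * nrm mu r%:E f `^ (1 - tl))%E.
Proof.
move=> mf l0 q0 r0 /andP[tl0 tl1] qE.
have tl1' : 0 < 1 - tl by rewrite subr_gt0.
pose a := q * tl; pose b := q * (1 - tl).
have a0 : 0 < a by rewrite mulr_gt0.
have b0 : 0 < b by rewrite mulr_gt0.
have := @hoelder _ X R mu (fun x => `|f x| `^ a) (fun x => `|f x| `^ b)
  (l / a) (r / b) (measurable_powR_norm _ mf) (measurable_powR_norm _ mf)
  (divr_gt0 l0 a0) (divr_gt0 r0 b0).
rewrite !invf_div.
have -> : a / l + b / r = 1.
  rewrite /a /b; have -> : q * tl / l + q * (1 - tl) / r =
    q * (tl / l + (1 - tl) / r) by ring.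
  by rewrite -qE mulfV// gt_eqF.
rewrite Lnorm1 => /(_ erefl) H.
have HL (p c : R) : 0 < p -> 0 < c ->
    (Lnorm mu (p / c)%:E (EFin \o (fun x => `|f x| `^ c)%R) = nrm mu p%:E f `^ c)%E.
  move=> p0 c0; rewrite /nrm !unlock invf_div (mulrC c) poweRrM; congr (_ `^ _)%E.
  congr (_ `^ _)%E; apply: eq_integral => x _ /=.
  rewrite ger0_norm ?powR_ge0// -powRrM mulrCA mulfV ?mulr1//.
  by rewrite gt_eqF.
rewrite !HL// in H.
rewrite -[leLHS](@poweRK _ q) ?nrm_ge0 ?gt_eqF//.
set B := (_ * _)%E.
have B0 : (0 <= B)%E by rewrite mule_ge0 ?poweR_ge0.
rewrite -[leRHS](@poweRK _ q) ?gt_eqF//.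
apply: poweR_le2r; [by rewrite invr_ge0 ltW | exact: poweR_ge0 |].
rewrite poweRM ?poweR_ge0// -!poweRrM poweR_nrm ?gt_eqF//.
rewrite ![_ * q]mulrC -/a -/b; apply: le_trans H.
rewrite le_eqVlt; apply/orP; left; apply/eqP; apply: eq_integral => x _ /=.
rewrite [`|_ * _|]ger0_norm; last by rewrite mulr_ge0 ?powR_ge0.
rewrite -powRD; first by congr (_ `^ _)%:E; rewrite /a /b; ring.
by rewrite gt_eqF// addr_gt0.
Qed.

(** Integrate |f|^q <= N^(q-l) |f|^l, valid almost everywhere with N the L^oo norm. *)
Lemma nrm_interpolation_infty (R : realType) (d : measure_display)
    (X : measurableType d) (mu : {measure set X -> \bar R}) (l q : R)
    (f : X -> R) :
  measurable_fun [set: X] f -> 0 < l -> l < q -> (nrm mu +oo f < +oo)%E ->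
  (nrm mu q%:E f <= nrm mu l%:E f `^ (l / q) * nrm mu +oo f `^ (1 - l / q))%E.
Proof.
move=> mf l0 lq foo.
have q0 : 0 < q by exact: lt_trans lq.
pose N := fine (nrm mu +oo f).
have NE : nrm mu +oo f = N%:E by rewrite fineK// ge0_fin_numE// nrm_ge0.
have N0 : 0 <= N by rewrite fine_ge0// nrm_ge0.
have fN : {ae mu, forall x, `|f x| <= N}.
  (* The L^oo norm is the essential supremum if [mu] is nonzero and 0 by convention otherwise; in
     the second case the whole space serves as the exceptional null set. *)
  have [mu0|] := ltP 0%E (mu setT).
    move: NE; rewrite /nrm unlock mu0 => NE.
    have := ess_sup_ge mu (abse \o (EFin \o f)); rewrite NE.
    by apply: filterS => x /=; rewrite lee_fin.
  move=> mu0; exists setT; split => //.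
  by apply/eqP; rewrite eq_le mu0 measure_ge0.
rewrite -[leLHS](@poweRK _ q) ?nrm_ge0 ?gt_eqF//.
have Iq : (nrm mu q%:E f `^ q <= (N `^ (q - l))%:E * nrm mu l%:E f `^ l)%E.
  rewrite !poweR_nrm ?gt_eqF//.
  have mfl : measurable_fun setT (fun x => (`|f x| `^ l)%:E).
    by apply/measurable_EFinP; exact: measurable_powR_norm.
  rewrite -(ge0_integralZl _ measurableT mfl) ?lee_fin ?powR_ge0//.
  apply: ae_ge0_le_integral => //.
  - by apply/measurable_EFinP; exact: measurable_powR_norm.
  - by move=> x _; rewrite -EFinM lee_fin mulr_ge0 ?powR_ge0.
  - apply/measurable_EFinP; apply: measurable_funM => //.
    exact: measurable_powR_norm.
  apply: filterS fN => x fxN _; rewrite -EFinM lee_fin.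
  have -> : `|f x| `^ q = `|f x| `^ (q - l) * `|f x| `^ l.
    by rewrite -powRD subrK// gt_eqF.
  by rewrite ler_wpM2r ?powR_ge0// powR_le2r// subr_ge0 ltW.
have qV : 0 <= q^-1 by rewrite invr_ge0 ltW.
apply: le_trans (poweR_le2r qV (poweR_ge0 _ _) Iq) _.
rewrite poweRM ?lee_fin ?powR_ge0 ?poweR_ge0// -poweRrM muleC NE poweR_EFin -powRrM.
by rewrite mulrBl mulfV// gt_eqF.
Qed.

(** The exponent solves 1/q = tl/l + (1-tl) [einv r]; for r = +oo it reduces to l/q. *)
Lemma nrm_interpolation (R : realType) (d : measure_display)
    (X : measurableType d) (mu : {measure set X -> \bar R}) (l q : R) (r : \bar R)
    (f : X -> R) (tl := (q^-1 - einv r) / (l^-1 - einv r)) :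
  measurable_fun [set: X] f -> 0 < l -> l < q -> (q%:E < r)%E ->
  (nrm mu r f < +oo)%E ->
  (nrm mu q%:E f <= nrm mu l%:E f `^ tl * nrm mu r f `^ (1 - tl))%E.
Proof.
move=> mf l0 lq qr foo; have q0 : 0 < q by exact: lt_trans lq.
case: r @tl qr foo => [r| |]//=; last first.
  move=> _ foo; rewrite !subr0.
  rewrite invrK mulrC; exact: nrm_interpolation_infty.
rewrite lte_fin => qr _; have r0 : 0 < r by exact: lt_trans qr.
have lrV : 0 < l^-1 - r^-1 by rewrite subr_gt0 ltf_pV2 ?posrE// (lt_trans lq).
have qrV : 0 < q^-1 - r^-1 by rewrite subr_gt0 ltf_pV2 ?posrE.
have lqV : 0 < l^-1 - q^-1 by rewrite subr_gt0 ltf_pV2 ?posrE.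
apply: nrm_interpolation_fin => //.
  rewrite divr_gt0//= ltr_pdivrMr// mul1r; lra.
have lrE : l^-1 - r^-1 != 0 by rewrite gt_eqF.
by move: lrE; set a := l^-1; set b := r^-1; set c := q^-1; move=> lrE; field.
Qed.

(** * Truncation and the passage from weak-type to strong bounds *)

Lemma norm_Glam (R : realType) (lam s : R) :
  0 <= lam -> `|Glam lam s| = Num.max (`|s| - lam) 0.
Proof.
move=> lam0; rewrite /Glam normrM normr_sg.
have m0 : 0 <= Num.max (`|s| - lam) 0 by rewrite le_max lexx orbT.
rewrite (ger0_norm m0); have [->|_] := eqVneq s 0; last by rewrite mul1r.
by rewrite mul0r normr0 sub0r; apply/esym/max_idPr; rewrite oppr_le0.
Qed.

Lemma Glam0 (R : realType) (s : R) : Glam 0 s = s.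
Proof.
by rewrite /Glam subr0 (max_idPl _)// mulr_sg_norm.
Qed.

Lemma measurable_norm_Glam (R : realType) (d : measure_display)
    (X : measurableType d) (lam : R) (f : X -> R) : 0 <= lam ->
  measurable_fun [set: X] f -> measurable_fun [set: X] (fun x => `|Glam lam (f x)|).
Proof.
move=> lam0 mf; under eq_fun do rewrite norm_Glam//.
apply: measurable_maxr => //; apply: measurable_funB => //.
exact: measurableT_comp.
Qed.

Lemma dyadic_bracket (R : realType) (a : R) :
  1 < a -> exists2 k, 2 ^+ k < a & a <= 2 ^+ k.+1.
Proof.
move=> a1.
have ex : exists n, a <= 2 ^+ n.
  exists (Num.Def.archi_bound a); exact/ltW/upper_nthrootP.
case: (ex_minnP ex) => -[|k] ak kmin.
  by move: ak; rewrite expr0 leNgt a1.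
exists k => //; rewrite ltNge; apply/negP => /kmin.
by rewrite ltnn.
Qed.

Lemma expr_powR (R : realType) (a b : R) k : 0 <= a -> (a ^+ k) `^ b = (a `^ b) ^+ k.
Proof.
by move=> a0; rewrite -powR_mulrn// powRAC powR_mulrn// powR_ge0.
Qed.

(* On the layer [2^k < |s| <= 2^(k+1)] one has [|s| <= 2 |G_(2^k/2) s|]. *)
Lemma powR_le_dyadic_Glam (R : realType) (l q s : R) : 0 < l -> l <= q ->
  ((`|s| `^ q)%:E <= (`|s| `^ l)%:E +
     \sum_(0 <= k <oo) (2 `^ l * (2 ^+ k.+1) `^ (q - l) *
        `|Glam (2 ^+ k / 2) s| `^ l)%:E)%E.
Proof.
move=> l0 lq; set S := (\sum_(0 <= k <oo) _)%E.
pose c k : R := 2 `^ l * (2 ^+ k.+1) `^ (q - l) * `|Glam (2 ^+ k / 2) s| `^ l.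
have c0 k : (0 <= (c k)%:E)%E by rewrite lee_fin !mulr_ge0 ?powR_ge0.
have S0 : (0 <= S)%E by apply: nneseries_ge0 => k _ _; exact: c0.
have q0 : 0 < q by exact: lt_le_trans lq.
have [s1|s1] := leP `|s| 1.
  apply: le_trans (leeDl _ S0); rewrite lee_fin.
  have [->|sn0] := eqVneq `|s| 0; first by rewrite !powR0// gt_eqF.
  by apply: ger_powR => //; rewrite s1 lt_neqAle eq_sym sn0 normr_ge0.
have [k ka ak] := dyadic_bracket s1.
have k0 : 0 < (2 : R) ^+ k by rewrite exprn_gt0.
apply: (@le_trans _ _ (c k)%:E).
  rewrite lee_fin /c norm_Glam; last by rewrite divr_ge0// ltW.
  rewrite (max_idPl _); last by lra.
  have -> : `|s| `^ q = `|s| `^ (q - l) * `|s| `^ l.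
    by rewrite -powRD subrK// gt_eqF.
  rewrite [_ * (2 ^+ _) `^ _]mulrC -mulrA -powRM//; last by lra.
  apply: ler_pM; rewrite ?powR_ge0//; apply: powR_le2r => //.
  - by rewrite subr_ge0.
  - exact: ltW.
  - by lra.
apply: (@le_trans _ _ S); last by rewrite leeDr// lee_fin powR_ge0.
(* The partial sum of length k+1 is the first one to contain the term of index k. *)
apply: le_trans (nneseries_lim_ge k.+1 _); last by move=> n _ _; exact: c0.
rewrite big_nat_recr//= leeDr//; exact: sume_ge0.
Qed.

(** Integrating the dyadic inequality gives a geometric series of ratio 2^(q-p), convergent since q
    < p. The bound [B] is chosen before [f], so that one constant serves all times. *)
Lemma weak_to_strong_bound (R : realType) (d : measure_display)
    (X : measurableType d) (mu : {measure set X -> \bar R}) (l q p C1 C2 : R) :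
  0 < l -> l < q -> q < p -> 0 <= C2 ->
  exists B : R, forall f : X -> R, measurable_fun [set: X] f ->
    (\int[mu]_x (`|f x| `^ l)%:E <= C1%:E)%E ->
    (forall lam : R, (0 < lam)%R ->
      \int[mu]_x (`|Glam lam (f x)| `^ l)%:E <= (C2 * lam `^ (l - p))%:E)%E ->
    (\int[mu]_x (`|f x| `^ q)%:E <= B%:E)%E.
Proof.
move=> l0 lq qp C20.
(* At level 2^k/2 the weak-type bound, weighted by 2^l (2^(k+1))^(q-l), equals A z^k; [A] collects
   the factors free of k. *)
pose z : R := 2 `^ (q - p).
pose A : R := 2 `^ l * 2 `^ (q - l) * C2 * 2 `^ (p - l).
have A0 : 0 <= A by rewrite !mulr_ge0 ?powR_ge0.
have z0 : 0 < z by rewrite powR_gt0.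
have z1 : `|z| < 1.
  rewrite ger0_norm ?ltW// /z -[ltRHS](powRr0 (2 : R)) /powR pnatr_eq0/=.
  rewrite ltr_expR mul0r nmulr_rlt0 ?subr_lt0// ln_gt0// ltr1n//.
exists (C1 + A / (1 - z)) => f mf fl fG.
pose T k x : \bar R :=
  (2 `^ l * (2 ^+ k.+1) `^ (q - l) * `|Glam (2 ^+ k / 2) (f x)| `^ l)%:E.
have pw k : 0 < (2 : R) ^+ k / 2 by rewrite divr_gt0// exprn_gt0.
have mG k : measurable_fun setT (fun x => (`|Glam (2 ^+ k / 2) (f x)| `^ l)%:E).
  apply/measurable_EFinP; apply: (measurableT_comp (measurable_powR l)).
  exact/measurable_norm_Glam/mf/ltW.
have mT k : measurable_fun setT (T k).
  apply/measurable_EFinP; apply: measurable_funM => //.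
  exact/measurable_EFinP/mG.
have T0 k x : (0 <= T k x)%E by rewrite lee_fin !mulr_ge0 ?powR_ge0.
have mfl r : measurable_fun setT (fun x => (`|f x| `^ r)%:E).
  by apply/measurable_EFinP; exact: measurable_powR_norm.
have mS : measurable_fun setT (fun x => \sum_(0 <= k <oo) T k x)%E.
  by apply: ge0_emeasurable_sum.
apply: (@le_trans _ _ (\int[mu]_x ((`|f x| `^ l)%:E + \sum_(0 <= k <oo) T k x))%E).
  apply: ge0_le_integral => //.
  - exact: emeasurable_funD.
  - by move=> x _; apply: powR_le_dyadic_Glam => //; exact: ltW.
rewrite ge0_integralD//; last by move=> x _; exact: nneseries_ge0.
rewrite EFinD; apply: leeD => //.
rewrite integral_nneseries//.
apply: (@le_trans _ _ (\sum_(0 <= k <oo) (A * z ^+ k)%:E)%E).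
  apply: lee_nneseries => [k _ _|k _]; first exact: integral_ge0.
  rewrite /T; under eq_integral do rewrite EFinM.
  rewrite ge0_integralZl//.
  apply: le_trans (lee_wpmul2l _ (fG _ (pw k))) _.
    by rewrite lee_fin mulr_ge0 ?powR_ge0.
  rewrite -EFinM lee_fin exprS !powRM// ?exprn_ge0//.
  rewrite -[(2^-1 : R)]powR_inv1// -powRrM mulN1r opprB.
  rewrite !expr_powR//.
  have -> : z ^+ k = (2 `^ (q - l)) ^+ k * (2 `^ (l - p)) ^+ k.
    rewrite -exprMn -powRD; first by rewrite addrA subrK.
    by rewrite pnatr_eq0 implybT.
  by rewrite /A le_eqVlt; apply/orP; left; apply/eqP; ring.
apply: lime_le.
  by apply: is_cvg_nneseries => k _ _; rewrite lee_fin mulr_ge0// exprn_ge0// ltW.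
near=> n; rewrite sumEFin lee_fin.
exact: (geometric_le_lim n A0 z0 z1).
Unshelve. all: by end_near. Qed.

(** * The L^l estimate drawn from the truncation estimate *)

(** The body repeats the hypothesis of the theorem verbatim, so that the hypothesis is accepted for
    it by conversion. *)
Definition truncation_decay (R : realType) (d : measure_display)
    (X : measurableType d) (mu : {measure set X -> \bar R}) (l omega T : R)
    (g u : R -> X -> R) :=
  forall s t lam, 0 <= s -> s <= t -> t <= T -> 0 <= lam ->
     (nrm mu l%:E (fun x => Glam lam (expR (- omega * t) * u t x)%R)
      <= nrm mu l%:E (fun x => Glam lam (expR (- omega * s) * u s x)%R)
         + \int[lebesgue_measure]_(tau in `[s, t]%classic)
             ((expR (- omega * tau))%:E *
              nrm mu l%:E (fun x => g tau x *
                 (if lam < expR (- omega * tau) * `|u tau x| then 1 else 0))%R))%E.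

Lemma le_nrm (R : realType) (d : measure_display) (X : measurableType d)
    (mu : {measure set X -> \bar R}) (p : R) (f g : X -> R) : 0 < p ->
  (forall x, `|f x| <= `|g x|) -> (nrm mu p%:E f <= nrm mu p%:E g)%E.
Proof.
move=> p0 fg; rewrite /nrm unlock; apply: poweR_le2r.
- by rewrite invr_ge0 ltW.
- by apply: integral_ge0 => x _; exact: poweR_ge0.
- apply: ge0_le_integral_subset => // x _; rewrite ?poweR_ge0//=.
  by rewrite lee_fin powR_le2r// ltW.
Qed.

Lemma nrmZ (R : realType) (d : measure_display) (X : measurableType d)
    (mu : {measure set X -> \bar R}) (p c : R) (f : X -> R) : 0 < p -> 0 <= c ->
  measurable_fun [set: X] f ->
  (nrm mu p%:E (fun x => c * f x)%R = c%:E * nrm mu p%:E f)%E.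
Proof.
move=> p0 c0 mf; rewrite /nrm unlock.
have mfp : measurable_fun setT (fun x => (`|f x| `^ p)%:E).
  by apply/measurable_EFinP; exact: measurable_powR_norm.
have -> : (\int[mu]_x `|(EFin \o (fun x => c * f x)%R) x| `^ p =
           (c `^ p)%:E * \int[mu]_x (`|f x| `^ p)%:E)%E.
  rewrite -(ge0_integralZl mu measurableT mfp) ?lee_fin ?powR_ge0//; apply: eq_integral => x _ /=.
  by rewrite normrM (ger0_norm c0) powRM// EFinM.
rewrite poweRM; [|by rewrite lee_fin powR_ge0|exact: integral_ge0].
by rewrite poweR_EFin powRK// gt_eqF.
Qed.

(** Dropping the indicator only enlarges |g|. The new integrand depends neither on [lam] nor on [u],
    so one tail estimate serves all levels. *)
Lemma truncation_decay_nrm (R : realType) (d : measure_display)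
    (X : measurableType d) (mu : {measure set X -> \bar R}) (l omega T : R)
    (g u : R -> X -> R) (s t lam : R) : 0 < l ->
  truncation_decay mu l omega T g u ->
  0 <= s -> s <= t -> t <= T -> 0 <= lam ->
  (nrm mu l%:E (fun x => Glam lam (expR (- omega * t) * u t x)%R)
      <= nrm mu l%:E (fun x => Glam lam (expR (- omega * s) * u s x)%R)
         + \int[lebesgue_measure]_(tau in `[s, t]%classic)
             ((expR (- omega * tau))%:E * nrm mu l%:E (g tau)))%E.
Proof.
move=> l0 H s0 st tT lam0; apply: le_trans (H _ _ _ s0 st tT lam0) _.
rewrite leeD2l//; apply: ge0_le_integral_subset => //.
- by move=> tau _; rewrite mule_ge0 ?nrm_ge0// lee_fin expR_ge0.
- by move=> tau _; rewrite mule_ge0 ?nrm_ge0// lee_fin expR_ge0.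
- move=> tau _; rewrite lee_wpmul2l ?lee_fin ?expR_ge0//; apply: le_nrm => // x.
  rewrite normrM; case: ifP => _; rewrite ?normr1 ?mulr1//.
  by rewrite normr0 mulr0.
Qed.

Lemma Ebd_ge0 (R : realType) (d : measure_display) (X : measurableType d)
  (mu : {measure set X -> \bar R}) (l omega : R) (u0 : X -> R)
  (g : R -> X -> R) (t : R) : (0 <= Ebd mu l omega u0 g t)%E.
Proof.
rewrite adde_ge0 ?mule_ge0 ?nrm_ge0 ?lee_fin ?expR_ge0//.
by apply: integral_ge0 => tau _; rewrite mule_ge0 ?nrm_ge0// lee_fin expR_ge0.
Qed.

Lemma le_Ebd (R : realType) (d : measure_display) (X : measurableType d)
    (mu : {measure set X -> \bar R}) (l omega : R) (u0 : X -> R)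
    (g : R -> X -> R) (s t : R) : 0 <= omega -> s <= t ->
  (Ebd mu l omega u0 g s <= Ebd mu l omega u0 g t)%E.
Proof.
move=> om0 st; apply: leeD.
  by rewrite lee_wpmul2r ?nrm_ge0// lee_fin ler_expR ler_wpM2l.
apply: ge0_le_integral_subset.
- by move=> tau _; rewrite mule_ge0 ?nrm_ge0// lee_fin expR_ge0.
- by move=> tau _; rewrite mule_ge0 ?nrm_ge0// lee_fin expR_ge0.
- by move=> tau; rewrite /= !in_itv/= => /andP[-> ts]; exact: le_trans st.
- by move=> tau _; rewrite lee_wpmul2r ?nrm_ge0// lee_fin ler_expR ler_wpM2l// lerD2r.
Qed.

Lemma Ebd_lty (R : realType) (d : measure_display) (X : measurableType d)
    (mu : {measure set X -> \bar R}) (l omega T : R) (u0 : X -> R)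
    (g : R -> X -> R) :
  0 <= omega ->
  measurable_fun (`[0, T]%classic : set R) (fun tau => nrm mu l%:E (g tau)) ->
  (nrm mu l%:E u0 < +oo)%E -> (L1Lp mu l%:E g 0 T < +oo)%E ->
  (Ebd mu l omega u0 g T < +oo)%E.
Proof.
move=> om0 mg u0oo goo; apply: lte_add_pinfty.
  by rewrite lte_mul_pinfty ?lee_fin ?expR_ge0.
apply: (@le_lt_trans _ _ (\int[lebesgue_measure]_(tau in `[0%R, T]%classic)
   ((expR (omega * T))%:E * nrm mu l%:E (g tau)))%E).
  apply: ge0_le_integral_subset => //.
  - by move=> tau _; rewrite mule_ge0 ?nrm_ge0// lee_fin expR_ge0.
  - by move=> tau _; rewrite mule_ge0 ?nrm_ge0// lee_fin expR_ge0.
  - move=> tau; rewrite /= in_itv/= => /andP[tau0 _].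
    rewrite lee_wpmul2r ?nrm_ge0// lee_fin ler_expR ler_wpM2l//; lra.
rewrite ge0_integralZl ?lee_fin ?expR_ge0//; last first.
  by move=> tau _; exact: nrm_ge0.
by rewrite lte_mul_pinfty ?lee_fin ?expR_ge0.
Qed.

(** This is the truncation estimate between times 0 and t at level 0, where [Glam] is the identity,
    multiplied by e^(omega t) to undo the damping. *)
Lemma nrm_le_Ebd (R : realType) (d : measure_display) (X : measurableType d)
    (mu : {measure set X -> \bar R}) (l omega T : R) (g u : R -> X -> R) (t : R) :
  0 < l -> truncation_decay mu l omega T g u ->
  measurable_fun (`[0, t]%classic : set R) (fun tau => nrm mu l%:E (g tau)) ->
  measurable_fun [set: X] (u t) -> 0 <= t -> t <= T ->
  (nrm mu l%:E (u t) <= Ebd mu l omega (u 0%R) g t)%E.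
Proof.
move=> l0 H mg mu_t t0 tT.
have := @truncation_decay_nrm _ _ _ _ _ _ _ _ _ _ _ _ l0 H (lexx 0) t0 tT (lexx 0).
under eq_fun do rewrite Glam0.
under [fun x => Glam 0 _]eq_fun do rewrite Glam0 mulr0 expR0 mul1r.
rewrite nrmZ ?expR_ge0// => {}H.
have -> : nrm mu l%:E (u t) = ((expR (omega * t))%:E *
    ((expR (- omega * t))%:E * nrm mu l%:E (u t)))%E.
  by rewrite muleA -EFinM -expRD mulNr subrr expR0 mul1e.
apply: le_trans (lee_wpmul2l _ H) _; first by rewrite lee_fin expR_ge0.
have mk (c : R) : measurable_fun (`[0, t]%classic : set R)
    (fun tau => (expR (c * tau))%:E * nrm mu l%:E (g tau))%E.
  apply: emeasurable_funM => //; apply/measurable_EFinP.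
  apply: (measurableT_comp (@measurable_expR R)); exact: mulrl_measurable.
rewrite ge0_muleDr ?nrm_ge0//; last first.
  by apply: integral_ge0 => tau _; rewrite mule_ge0 ?nrm_ge0// lee_fin expR_ge0.
rewrite /Ebd leeD2l//.
rewrite [leRHS](_ : _ = \int[lebesgue_measure]_(tau in `[0%R, t]%classic)
  ((expR (omega * t))%:E * ((expR (- omega * tau))%:E * nrm mu l%:E (g tau))))%E.
  rewrite ge0_integralZl ?lee_fin ?expR_ge0//; first exact: mk.
  by move=> tau _; rewrite mule_ge0 ?nrm_ge0// lee_fin expR_ge0.
apply: eq_integral => tau _.
by rewrite muleA -EFinM -expRD mulrBr mulNr.
Qed.

(** * A bound on the L^q norm at every time *)

(** A nonempty open interval has positive length, so no null set covers it. *)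
Lemma ae_exists_itv (R : realType) (P : R -> Prop) (a b : R) :
  {ae lebesgue_measure, forall t, P t} -> a < b -> exists2 s, a < s < b & P s.
Proof.
move=> [N [mN N0 PN]] ab; apply: contrapT => noP.
have sub : `]a, b[%classic `<=` N.
  move=> s sab; apply: PN => /= Ps; apply: noP; exists s.
    by move: sab; rewrite /= in_itv.
  exact: Ps.
have : (lebesgue_measure `]a, b[%classic <= lebesgue_measure N)%E.
  by apply: le_measure => //; rewrite inE//; exact: measurable_itv.
rewrite [X in (_ <= X)%E -> _]N0 lebesgue_measure_itv/= lte_fin ab.
by rewrite -EFinD lee_fin leNgt subr_gt0 ab.
Qed.

(** The weak-type argument requires a finite exponent above q: r itself if finite, otherwise q + 1,
    reached by interpolation between L^l and L^oo. The constant survives since C^tl C^(1-tl) = C. *)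
Lemma intermediate_exponent (R : realType) (d : measure_display)
    (X : measurableType d) (mu : {measure set X -> \bar R}) (l q C : R)
    (r : \bar R) :
  0 < l -> l < q -> (q%:E < r)%E -> 0 <= C ->
  exists2 p : R, q < p & forall f : X -> R, measurable_fun [set: X] f ->
    (nrm mu l%:E f <= C%:E)%E -> (nrm mu r f <= C%:E)%E ->
    (nrm mu p%:E f <= C%:E)%E.
Proof.
move=> l0 lq; case: r => [r| |]//; first by rewrite lte_fin => qr _; exists r.
move=> _ C0; exists (q + 1); first by lra.
move=> f mf fl fr.
have lp : l < q + 1 by lra.
have p0 : 0 < q + 1 by lra.
have foo : (nrm mu +oo f < +oo)%E by exact: le_lt_trans fr (ltry _).
apply: le_trans (nrm_interpolation_infty mf l0 lp foo) _.
have e0 : 0 <= l / (q + 1) by rewrite divr_ge0// ltW.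
have e1 : 0 <= 1 - l / (q + 1) by rewrite subr_ge0 ler_pdivrMr// mul1r ltW.
apply: le_trans (lee_pmul (poweR_ge0 _ _) (poweR_ge0 _ _)
  (poweR_le2r e0 (nrm_ge0 _ _ _) fl) (poweR_le2r e1 (nrm_ge0 _ _ _) fr)) _.
by rewrite !poweR_EFin -EFinM powR_split.
Qed.

(** Chebyshev's argument: where |f| > lam, the truncation is at most |f|, and |f|^l = |f|^(l-p)
    |f|^p <= lam^(l-p) |f|^p because l < p. *)
Lemma integral_Glam_le (R : realType) (d : measure_display)
    (X : measurableType d) (mu : {measure set X -> \bar R}) (l p lam : R)
    (f : X -> R) : 0 < l -> l < p -> 0 < lam -> measurable_fun [set: X] f ->
  (\int[mu]_x (`|Glam lam (f x)| `^ l)%:E <=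
     (lam `^ (l - p))%:E * \int[mu]_x (`|f x| `^ p)%:E)%E.
Proof.
move=> l0 lp lam0 mf.
have mfp : measurable_fun setT (fun x => (`|f x| `^ p)%:E).
  by apply/measurable_EFinP; exact: measurable_powR_norm.
rewrite -(ge0_integralZl _ measurableT mfp) ?lee_fin ?powR_ge0//.
apply: ge0_le_integral_subset => //.
- by move=> x _; rewrite mule_ge0 ?lee_fin ?powR_ge0.
- move=> x _; rewrite -EFinM lee_fin norm_Glam; last exact: ltW.
  have [fx|fx] := leP `|f x| lam.
    rewrite (max_idPr _) ?subr_le0// powR0 ?gt_eqF//.
    by rewrite mulr_ge0 ?powR_ge0.
  have fx0 : 0 < `|f x| by exact: lt_trans fx.
  rewrite (max_idPl _) ?subr_ge0 ?(ltW fx)//.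
  apply: (@le_trans _ _ (`|f x| `^ l)).
    apply: powR_le2r; [exact: ltW | by rewrite subr_ge0 ltW |].
    by rewrite lerBlDr lerDl ltW.
  have -> : `|f x| `^ l = `|f x| `^ (l - p) * `|f x| `^ p.
    by rewrite -powRD subrK// gt_eqF.
  rewrite ler_wpM2r ?powR_ge0// -opprB !powRN lef_pV2 ?posrE ?powR_gt0//.
  by rewrite powR_le2r ?subr_ge0 ?(ltW lp) ?(ltW lam0) ?(ltW fx).
Qed.

(* The essential bound on [u] holds only for almost every time.  The truncation
   estimate carries the resulting weak-type bound, level by level, to every time. *)
Lemma truncation_decay_uniform_bound (R : realType) (d : measure_display)
    (X : measurableType d) (mu : {measure set X -> \bar R}) (l q : R) (r : \bar R)
    (T omega : R) (g u : R -> X -> R) :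
  0 < l -> l < q -> (q%:E < r)%E -> 0 <= omega ->
  measurable_fun (`[0, T]%classic : set R) (fun tau => nrm mu l%:E (g tau)) ->
  (L1Lp mu l%:E g 0 T < +oo)%E ->
  (forall t, t \in `[0, T] -> measurable_fun [set: X] (u t)) ->
  (nrm mu l%:E (u 0%R) < +oo)%E ->
  (exists C : R, {ae lebesgue_measure, forall t, t \in `[0, T] ->
     (nrm mu l%:E (u t) <= C%:E)%E /\ (nrm mu r (u t) <= C%:E)%E}) ->
  truncation_decay mu l omega T g u ->
  exists B : R, forall t, 0 < t -> t <= T -> (nrm mu q%:E (u t) <= B%:E)%E.
Proof.
move=> l0 lq qr om0 mg goo mfu u0oo [C0 uC0] decay.
pose C := Num.max C0 0.
have C_ge0 : 0 <= C by rewrite le_max lexx orbT.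
have CC0 : (C0%:E <= C%:E)%E by rewrite lee_fin le_max lexx.
have [p qp pC] := @intermediate_exponent _ _ _ mu l q C r l0 lq qr C_ge0.
have q0 : 0 < q by exact: lt_trans lq.
have lp : l < p by exact: lt_trans qp.
have p0 : 0 < p by exact: lt_trans qp.
have l_neq0 : l != 0 by rewrite gt_eqF.
pose E := Ebd mu l omega (u 0) g T.
have Efin : E \is a fin_num by rewrite ge0_fin_numE ?Ebd_ge0 ?Ebd_lty.
pose v t x := expR (- omega * t) * u t x.
have le1 t : 0 <= t -> expR (- omega * t) <= 1.
  by move=> t0; rewrite -expR0 ler_expR mulNr oppr_le0 mulr_ge0.
have vu t x : 0 <= t -> `|v t x| <= `|u t x|.
  move=> t0; rewrite /v normrM ger0_norm ?expR_ge0// ler_piMl//.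
  exact: le1.
have mv t : t \in `[0, T] -> measurable_fun [set: X] (v t).
  by move=> tT; apply: measurable_funM => //; exact: mfu.
(* E(T)^l bounds the integral of |v(t)|^l at every time, and C^p is the weak-type constant inherited
   from the good times. *)
have [B BP] := @weak_to_strong_bound _ _ X mu l q p (fine E `^ l) (C `^ p)
   l0 lq qp (powR_ge0 _ _).
(* The factor e^(omega T) undoes the damping in [v]; the absolute value covers a [B] of unknown
   sign. *)
exists (expR (omega * T) * (`|B| `^ q^-1)) => t t0 tT.
have tI : t \in `[0, T] by rewrite in_itv/= (ltW t0).
have mgt : measurable_fun (`[0, t]%classic : set R) (fun tau => nrm mu l%:E (g tau)).
  apply: measurable_funS mg => //.
  by move=> x; rewrite /= !in_itv/= => /andP[-> xt]; exact: le_trans tT.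
have vq : (\int[mu]_x (`|v t x| `^ q)%:E <= B%:E)%E.
  apply: BP; first exact: mv.
    rewrite -poweR_nrm// -poweR_EFin fineK//; apply: poweR_le2r; rewrite ?nrm_ge0 ?(ltW l0)//.
    apply: le_trans (le_nrm mu l0 (fun x => vu t x (ltW t0))) _.
    apply: le_trans (nrm_le_Ebd l0 decay mgt (mfu _ tI) (ltW t0) tT) _.
    exact: le_Ebd.
  move=> lam lam0; set K := _ * _.
  have K0 : 0 <= K by rewrite mulr_ge0 ?powR_ge0.
  rewrite -poweR_nrm// -[K](powRVK l_neq0)// -poweR_EFin.
  apply: poweR_le2r; rewrite ?nrm_ge0 ?(ltW l0)//.
  (* A loss e is allowed: s < t is taken late enough for the integral of |g|_l over [s, t] to be at
     most e, and outside the null set where the essential bound fails. *)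
  apply/lee_addgt0Pr => e e0.
  have goot : (\int[lebesgue_measure]_(tau in `[0%R, t]%classic)
      nrm mu l%:E (g tau) < +oo)%E.
    apply: le_lt_trans goo; apply: ge0_le_integral_subset.
    - by move=> *; exact: nrm_ge0.
    - by move=> *; exact: nrm_ge0.
    - by move=> x; rewrite /= !in_itv/= => /andP[-> xt]; exact: le_trans tT.
    - by [].
  have [s0 /andP[s0_ge0 s0t] tail] := ge0_integral_tail_le t0 e0 mgt
    (fun x _ => nrm_ge0 _ _ _) goot.
  have [s /andP[s0s st] uC] := ae_exists_itv uC0 s0t.
  have s_ge0 : 0 <= s by exact: le_trans (ltW s0s).
  have sI : s \in `[0, T] by rewrite in_itv/= s_ge0 (le_trans (ltW st)).
  have [ul ur] := uC sI.
  apply: le_trans (truncation_decay_nrm l0 decay s_ge0 (ltW st) tT (ltW lam0)) _.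
  apply: leeD.
    rewrite -poweR_EFin -[leLHS](poweRK l_neq0) ?nrm_ge0//.
    apply: poweR_le2r; rewrite ?invr_ge0 ?(ltW l0) ?poweR_ge0//.
    rewrite poweR_nrm//.
    apply: le_trans (integral_Glam_le mu l0 lp lam0 (mv _ sI)) _.
    rewrite /K mulrC EFinM lee_wpmul2l ?lee_fin ?powR_ge0//.
    rewrite -poweR_nrm ?gt_eqF// -poweR_EFin.
    apply: poweR_le2r; rewrite ?nrm_ge0 ?(ltW p0)//.
    apply: le_trans (le_nrm mu p0 (fun x => vu s x s_ge0)) _.
    by apply: pC; [exact: mfu | exact: le_trans CC0 | exact: le_trans CC0].
  apply: le_trans (tail _ s0s (ltW st)); apply: ge0_le_integral_subset => //.
  - by move=> tau _; rewrite mule_ge0 ?nrm_ge0// lee_fin expR_ge0.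
  - by move=> *; exact: nrm_ge0.
  - move=> tau; rewrite /= in_itv/= => /andP[stau _].
    rewrite -[leRHS]mul1e lee_wpmul2r ?nrm_ge0// lee_fin le1//.
    exact: le_trans stau.
have -> : u t = (fun x => expR (omega * t) * v t x).
  by apply/funext => x; rewrite /v mulrA -expRD mulNr subrr expR0 mul1r.
rewrite nrmZ ?expR_ge0//; last exact: mv.
rewrite EFinM; apply: lee_pmul; rewrite ?nrm_ge0 ?lee_fin ?expR_ge0//.
  by rewrite ler_expR ler_wpM2l.
rewrite -poweR_EFin -[leLHS](@poweRK _ q) ?gt_eqF ?nrm_ge0//.
apply: poweR_le2r; rewrite ?invr_ge0 ?(ltW q0) ?poweR_ge0//.
rewrite poweR_nrm ?gt_eqF//; apply: le_trans vq _.
by rewrite lee_fin ler_norm.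
Qed.

(** * The root of the smoothing estimate and the weight [Mfun] *)

Lemma powR_max (R : realType) (p a b : R) : 0 <= p -> 0 <= a -> 0 <= b ->
  Num.max a b `^ p = Num.max (a `^ p) (b `^ p).
Proof.
move=> p0 a0 b0; have [ab|ba] := leP a b.
  by apply/esym/max_idPr/powR_le2r.
by apply/esym/max_idPl/powR_le2r => //; exact: ltW.
Qed.

(** In the second branch A^(gammas/gamma) is at most 1 if A <= 1 and at most A otherwise. The first
    case produces the additive c2^(1/gamma), which is the source of that term in the numerator of
    [Nfun]. *)
Lemma smoothing_root (R : realType) (x c1 c2 k A alpha gamma gammas : R) :
  0 < gamma -> 0 < gammas -> gammas <= gamma ->
  0 <= x -> 0 <= c1 -> 0 <= c2 -> 0 <= k -> 0 <= A ->
  x <= Num.max (c1 * k `^ alpha * A `^ gamma) (c2 * A `^ gammas) ->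
  x `^ gamma^-1 <=
    Num.max (c1 `^ gamma^-1 * k `^ (alpha / gamma)) (c2 `^ gamma^-1) * A
    + c2 `^ gamma^-1.
Proof.
move=> g0 gs0 gsg x0 c10 c20 k0 A0 xle.
have gV0 : 0 <= gamma^-1 by rewrite invr_ge0 ltW.
set M := Num.max _ (c2 `^ _).
have M1 : c1 `^ gamma^-1 * k `^ (alpha / gamma) <= M by rewrite le_max lexx.
have M2 : c2 `^ gamma^-1 <= M by rewrite le_max lexx orbT.
apply: le_trans (powR_le2r gV0 x0 xle) _.
rewrite powR_max//; [|by rewrite !mulr_ge0 ?powR_ge0|by rewrite mulr_ge0 ?powR_ge0].
rewrite ge_max !powRM ?mulr_ge0 ?powR_ge0// powRK ?gt_eqF//.
rewrite -powRrM; apply/andP; split.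
  by apply: ler_wpDr; rewrite ?powR_ge0// ler_wpM2r.
rewrite -powRrM; have [A1|A1] := leP A 1.
  apply: ler_wpDl.
    by rewrite mulr_ge0// (le_trans _ M2)// powR_ge0.
  rewrite ler_piMr ?powR_ge0//.
  have gsg0 : 0 <= gammas / gamma by rewrite divr_ge0// ltW.
  by have := powR_le2r gsg0 A0 A1; rewrite powR1.
apply: ler_wpDr; rewrite ?powR_ge0//.
apply: ler_pM; rewrite ?powR_ge0//.
by apply: ler1_powR; [exact: ltW | rewrite ler_pdivrMr// mul1r].
Qed.

Lemma ediv_le_mul (R : realType) (x y n : R) : 0 <= x -> 0 <= y -> 0 <= n ->
  (x%:E / y%:E <= n%:E)%E -> x <= n * y.
Proof.
move=> x0; rewrite le_eqVlt => /predU1P[<-|y0] n0.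
  (* The inverse of 0 is +oo, so for y = 0 a finite quotient forces x = 0. *)
  rewrite inve0; move: x0; rewrite le_eqVlt => /predU1P[<-|x0].
    by rewrite mulr0.
  by rewrite gt0_muley ?lte_fin// leye_eq.
by rewrite inver gt_eqF// -EFinM lee_fin ler_pdivrMr.
Qed.

Lemma Mfun_ge0 (R : realType) (c1 c2 : R -> R) (alpha gamma omega s : R) :
  0 <= Mfun c1 c2 alpha gamma omega s.
Proof. by rewrite le_max mulr_ge0 ?powR_ge0. Qed.

(** The constant comes from 2/s + omega <= 2 (1/s + omega), while [c1] and [c2] do not decrease from
    s/2 to s. *)
Lemma Mfun_half_le (R : realType) (c1 c2 : R -> R) (alpha gamma omega T s : R) :
  {in `[0, T] &, {homo c1 : a b / a <= b}} ->
  {in `[0, T] &, {homo c2 : a b / a <= b}} ->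
  (forall t, t \in `[0, T] -> 0 < c1 t) ->
  (forall t, t \in `[0, T] -> 0 <= c2 t) ->
  0 <= omega -> 0 <= alpha -> 0 < gamma -> 0 < s -> s <= T ->
  Mfun c1 c2 alpha gamma omega (s / 2) <=
    2 `^ (alpha / gamma) * Mfun c1 c2 alpha gamma omega s.
Proof.
move=> c1h c2h c10 c20 om0 al0 g0 s0 sT.
have gV0 : 0 <= gamma^-1 by rewrite invr_ge0 ltW.
have ag0 : 0 <= alpha / gamma by rewrite mulr_ge0.
have sI : s \in `[0, T] by rewrite in_itv/= (ltW s0).
have s2I : s / 2 \in `[0, T] by rewrite in_itv/=; apply/andP; split; lra.
have s2s : s / 2 <= s by lra.
have two1 : 1 <= 2 `^ (alpha / gamma) :> R.
  by rewrite -[leLHS](powRr0 (2 : R)) ler_powR// ler1n.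
have sV0 : 0 < s^-1 by rewrite invr_gt0.
rewrite /Mfun ge_max; apply/andP; split.
  apply: (@le_trans _ _ (2 `^ (alpha / gamma) *
      (c1 s `^ gamma^-1 * (s^-1 + omega) `^ (alpha / gamma)))); last first.
    by rewrite ler_wpM2l ?powR_ge0// le_max lexx.
  rewrite mulrCA -powRM//; last by rewrite addr_ge0// ltW.
  apply: ler_pM; rewrite ?powR_ge0//.
    by apply: powR_le2r => //; [exact/ltW/c10 | exact: c1h].
  by apply: powR_le2r => //; rewrite invf_div; lra.
apply: (@le_trans _ _ (c2 s `^ gamma^-1)).
  by apply: powR_le2r => //; [exact: c20 | exact: c2h].
apply: (@le_trans _ _ (Mfun c1 c2 alpha gamma omega s)).
  by rewrite le_max lexx orbT.
by rewrite ler_peMl// Mfun_ge0.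
Qed.

(** A lower bound uniform in s, from c1(s) >= c1(0) and 1/s >= 1/T. It lets M be dominated by a
    multiple of M^(1/theta) in the a priori bound on [w]. *)
Lemma Mfun_lower (R : realType) (c1 c2 : R -> R) (alpha gamma omega T s : R) :
  {in `[0, T] &, {homo c1 : a b / a <= b}} ->
  (forall t, t \in `[0, T] -> 0 < c1 t) ->
  0 <= omega -> 0 <= alpha -> 0 < gamma -> 0 < s -> s <= T ->
  c1 0 `^ gamma^-1 * T^-1 `^ (alpha / gamma) <= Mfun c1 c2 alpha gamma omega s.
Proof.
move=> c1h c10 om0 al0 g0 s0 sT.
have T0 : 0 < T by exact: lt_le_trans sT.
have gV0 : 0 <= gamma^-1 by rewrite invr_ge0 ltW.
have sI : s \in `[0, T] by rewrite in_itv/= (ltW s0).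
have zI : 0 \in `[0, T] by rewrite in_itv/= lexx ltW.
rewrite /Mfun le_max; apply/orP; left; apply: ler_pM; rewrite ?powR_ge0//.
  by apply: powR_le2r => //; [exact/ltW/c10 | exact: c1h zI sI (ltW s0)].
apply: powR_le2r; [by rewrite mulr_ge0 | by rewrite invr_ge0 ltW |].
by apply: ler_wpDr => //; rewrite lef_pV2 ?posrE.
Qed.

(** Identifies the power of M produced by the comparison with the maximum in the claim. *)
Lemma Mfun_powR (R : realType) (c1 c2 : R -> R) (alpha gamma omega theta t : R) :
  0 < gamma -> 0 < theta ->
  Mfun c1 c2 alpha gamma omega t `^ (gamma / theta) =
  Num.max (c1 t `^ theta^-1 * (t^-1 + omega) `^ (alpha / theta))
          (c2 t `^ theta^-1).
Proof.
move=> g0 th0.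
have gn : gamma != 0 by rewrite gt_eqF.
rewrite powR_max ?mulr_ge0 ?powR_ge0 ?invr_ge0 ?ltW//.
rewrite powRM ?powR_ge0// -!powRrM mulKf//.
by rewrite -(mulrA alpha) mulKf.
Qed.

(** * The degenerate case and the final comparison *)

Lemma nrm_ae0 (R : realType) (d : measure_display) (X : measurableType d)
    (mu : {measure set X -> \bar R}) (r : \bar R) (f : X -> R) :
  measurable_fun [set: X] f -> (0 < r)%E ->
  (EFin \o f) = \0%E %[ae mu] -> nrm mu r f = 0%E.
Proof.
move=> mf; case: r => [r| |]// r0 f0; rewrite /nrm unlock.
  move: r0; rewrite lte_fin => r0.
  suff -> : (\int[mu]_x `|(EFin \o f) x| `^ r = 0)%E.
    by rewrite poweR0r// invr_eq0 gt_eqF.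
  rewrite -(integral0 mu setT); apply: ae_eq_integral => //.
  - by apply/measurable_EFinP; exact: measurable_powR_norm.
  - apply: filterS f0 => x /= /(_ I)[fx] _.
    by rewrite fx normr0 powR0// gt_eqF.
by case: ifPn => // mu0; exact: abs_ess_sup_eq0.
Qed.


Theorem theorem4p6 (R : realType) (d : measure_display) (X : measurableType d)
  (mu : {measure set X -> \bar R}) (l q : R) (r : \bar R) (T : R)
  (g u : R -> X -> R) (omega alpha gamma gammas : R) (c1 c2 : R -> R) :
  sigma_finite [set: X] mu ->
  1 <= l -> l < q -> (q%:E < r)%E -> 0 < T ->
  (* g in L^1(0,T; L^l_mu \cap L^q_mu) *)
  measurable_fun (`[0, T] `*` [set: X]) (fun p : R * X => g p.1 p.2) ->
  (L1Lp mu l%:E g 0 T < +oo)%E -> (L1Lp mu q%:E g 0 T < +oo)%E ->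
  (* u in L^infty(0,T; L^l_mu \cap L^r_mu) *)
  (forall t, t \in `[0, T] ->
     measurable_fun [set: X] (u t) /\
     (nrm mu l%:E (u t) < +oo)%E /\ (nrm mu r (u t) < +oo)%E) ->
  (exists C : R, {ae lebesgue_measure, forall t, t \in `[0, T] ->
     (nrm mu l%:E (u t) <= C%:E)%E /\ (nrm mu r (u t) <= C%:E)%E}) ->
  0 <= omega ->
  (* the G_lambda estimate *)
  (forall s t lam, 0 <= s -> s <= t -> t <= T -> 0 <= lam ->
     (nrm mu l%:E (fun x => Glam lam (expR (- omega * t) * u t x)%R)
      <= nrm mu l%:E (fun x => Glam lam (expR (- omega * s) * u s x)%R)
         + \int[lebesgue_measure]_(tau in `[s, t]%classic)
             ((expR (- omega * tau))%:E *
              nrm mu l%:E (fun x => g tau x *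
                 (if lam < expR (- omega * tau) * `|u tau x| then 1 else 0))%R))%E) ->
  (* c1, c2 increasing on [0,T], c1 > 0, c2 >= 0 *)
  {in `[0, T] &, {homo c1 : a b / a <= b}} ->
  {in `[0, T] &, {homo c2 : a b / a <= b}} ->
  (forall t, t \in `[0, T] -> 0 < c1 t) ->
  (forall t, t \in `[0, T] -> 0 <= c2 t) ->
  0 <= alpha -> 0 < gammas -> gammas <= gamma ->
  (* the smoothing estimate *)
  (forall t, 0 < t -> t <= T ->
     (nrm mu r (u t) <=
      maxe ((c1 (t / 2) * powR (2 / t + omega) alpha)%R%:E *
              poweR (nrm mu q%:E (u (t / 2)%R) + L1Lp mu q%:E g (t / 2)%R t) gamma)
           ((c2 (t / 2))%R%:E *
              poweR (nrm mu q%:E (u (t / 2)%R) + L1Lp mu q%:E g (t / 2)%R t) gammas))%E) ->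
  let theta := 1 - gamma * ((l^-1 - q^-1) / (l^-1 - einv r)) in
  let theta_l := (q^-1 - einv r) / (l^-1 - einv r) in
  0 < theta ->
  forall t, 0 < t -> t <= T ->
  (nrm mu r (u t) <=
     (powR 2 gamma)%R%:E *
     poweR ((powR 2 (alpha / (gamma * theta))%R)%:E +
            ereal_sup [set poweR (Nfun mu l q c1 c2 alpha gamma omega theta theta_l
                                     (u 0%R) g s) theta
                      | s in `]0%R, t]%classic])
           (gamma / theta)%R *
     (Num.max (powR (c1 t) theta^-1 * powR (t^-1 + omega) (alpha / theta))
              (powR (c2 t) theta^-1))%R%:E *
     poweR (Ebd mu l omega (u 0%R) g t) (theta_l * gamma / theta)%R)%E.
Proof.
move=> sfmu l1 lq qr T0 mg gl gq hu uC om0 decay c1h c2h c10 c20 al0 gs0 gsg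
  smooth theta theta_l th0 t t0 tT.
have l0 : 0 < l by exact: lt_le_trans l1.
have q0 : 0 < q by exact: lt_trans lq.
have g0 : 0 < gamma by exact: lt_le_trans gsg.
have r0 : (0 < r)%E by apply: lt_trans qr; rewrite lte_fin.
have lqV : 0 < l^-1 - q^-1 by rewrite subr_gt0 ltf_pV2 ?posrE.
have qrV : 0 < q^-1 - einv r.
  case: (r) qr => [r'| |]//=; last by rewrite subr0 invr_gt0.
  by rewrite lte_fin => qr'; rewrite subr_gt0 ltf_pV2 ?posrE// (lt_trans q0).
have lrV : 0 < l^-1 - einv r by lra.
have tl0 : 0 < theta_l by rewrite divr_gt0.
(* Interpolation yields the power 1 - theta_l of |u|_r = w^gamma; in terms of [w] this is exactly
   the exponent 1 - theta of the recursion. *)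
have thE : 1 - theta = gamma * (1 - theta_l).
  rewrite /theta /theta_l.
  have lrE : l^-1 - einv r != 0 by rewrite gt_eqF.
  by move: lrE; set a := l^-1; set b := einv r; set c := q^-1; move=> lrE; field.
have th1 : theta < 1.
  by rewrite -subr_gt0 /theta opprB addrCA subrr addr0 mulr_gt0// divr_gt0.
have thn : theta != 0 by rewrite gt_eqF.
have gn : gamma != 0 by rewrite gt_eqF.
have mu_ s : s \in `[0, T] -> measurable_fun [set: X] (u s) by move=> /hu[].
have ul s : s \in `[0, T] -> (nrm mu l%:E (u s) < +oo)%E by move=> /hu[_ []].
have ur s : s \in `[0, T] -> (nrm mu r (u s) < +oo)%E by move=> /hu[_ []].
have zI : 0 \in `[0, T] by rewrite in_itv/= lexx ltW.
have sI s : 0 < s -> s <= T -> s \in `[0, T].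
  by move=> s0 sT; rewrite in_itv/= (ltW s0).
have mgl : measurable_fun (`[0, T]%classic : set R) (fun tau => nrm mu l%:E (g tau)).
  by apply: measurable_fun_nrm => //; exact: measurable_itv.
have mglt s : s <= T ->
    measurable_fun (`[0, s]%classic : set R) (fun tau => nrm mu l%:E (g tau)).
  move=> sT; apply: measurable_funS mgl => // x; rewrite /= !in_itv/= => /andP[-> xs].
  exact: le_trans sT.
set E := Ebd mu l omega (u 0) g.
have E0 s : (0 <= E s)%E by exact: Ebd_ge0.
have ET : (E T < +oo)%E by apply: Ebd_lty => //; exact: ul.
have Emono s s' : s <= s' -> (E s <= E s')%E by exact: le_Ebd.
have Efin s : s <= T -> E s \is a fin_num.
  by move=> sT; rewrite ge0_fin_numE//; exact: le_lt_trans (Emono _ _ sT) ET.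
have uE s : 0 < s -> s <= T -> (nrm mu l%:E (u s) <= E s)%E.
  move=> s0 sT; apply: (nrm_le_Ebd l0 decay) => //; [exact: mglt | exact/mu_/sI | exact: ltW].
have tlg0 : theta_l * gamma / theta != 0 by rewrite gt_eqF// divr_gt0// mulr_gt0.
(* The comparison divides by a power of E(t). If E(t) = 0, the L^l estimate makes u(t) vanish almost
   everywhere and both sides are 0. *)
have := E0 t; rewrite le_eqVlt => /predU1P[Et0|Et_gt0].
  have unull : nrm mu r (u t) = 0%E.
    have ul0 : nrm mu l%:E (u t) = 0%E.
      by apply/eqP; rewrite eq_le nrm_ge0 andbT Et0 uE.
    have mEu : measurable_fun [set: X] (EFin \o u t) by exact/measurable_EFinP/mu_/sI.
    have l0E : (0 < l%:E)%E by rewrite lte_fin.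
    exact: nrm_ae0 (mu_ _ (sI _ t0 tT)) r0 (Lnorm_eq0_eq0 mEu l0E ul0).
  by rewrite unull -Et0 poweR0r// mule0.
set S := ereal_sup _.
have E_gt0 : (0 < E t `^ (theta_l * gamma / theta))%E by exact: poweR_gt0.
pose M := Mfun c1 c2 alpha gamma omega.
rewrite -(@Mfun_powR _ c1 c2 alpha gamma omega theta t g0 th0) -/(M t).
pose m0 := c1 0 `^ gamma^-1 * T^-1 `^ (alpha / gamma).
have m0_gt0 : 0 < m0.
  by rewrite mulr_gt0 ?powR_gt0 ?invr_gt0// c10.
have Mm0 s : 0 < s -> s <= T -> m0 <= M s.
  by move=> s0 sT; exact: (Mfun_lower c2 c1h c10 om0 al0 g0 s0 sT).
have M0 s : 0 < s -> s <= T -> 0 < M s.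
  by move=> s0 sT; exact: lt_le_trans (Mm0 _ s0 sT).
(* [Nfun] is already a supremum over (0, t], so its value at t controls the source term at all s <=
   t. *)
pose Nt := Nfun mu l q c1 c2 alpha gamma omega theta theta_l (u 0) g t.
have NtS : (Nt `^ theta <= S)%E.
  by apply: ereal_sup_ubound; exists t => //=; rewrite in_itv/= t0 lexx.
have S0 : (0 <= S)%E by apply: le_trans NtS; exact: poweR_ge0.
pose K : R := 2 `^ (alpha / (gamma * theta)).
have K_gt0 : 0 < K by rewrite powR_gt0.
have gth0 : 0 < gamma / theta by rewrite divr_gt0.
(* With S = +oo the right-hand side is +oo, the remaining factors being positive; below, S and hence
   N(t) are finite. *)
have [Soo|Soo] := eqVneq S +oo%E.
  rewrite Soo addey// poweRyr ?gt_eqF//.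
  rewrite gt0_muley ?lte_fin ?powR_gt0//.
  rewrite gt0_mulye ?lte_fin ?powR_gt0 ?M0//.
  by rewrite gt0_mulye// leey.
have Sfin : S \is a fin_num by rewrite ge0_fin_numE// ltey.
have Ntoo : (Nt < +oo)%E.
  apply: (@lty_poweRy _ _ theta) => //; apply: le_lt_trans NtS _.
  by rewrite ltey.
pose L s := L1Lp mu q%:E g (s / 2) s.
have L0 s : (0 <= L s)%E by apply: integral_ge0 => tau _; exact: nrm_ge0.
have LT s : 0 < s -> s <= T -> (L s <= L1Lp mu q%:E g 0 T)%E.
  move=> s0 sT; apply: ge0_le_integral_subset => //.
  - by move=> tau _; exact: nrm_ge0.
  - by move=> tau _; exact: nrm_ge0.
  - move=> tau; rewrite /= !in_itv/= => /andP[stau taus]; apply/andP; split; lra.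
have Lfin s : 0 < s -> s <= T -> L s \is a fin_num.
  by move=> s0 sT; rewrite ge0_fin_numE//; exact: le_lt_trans (LT _ s0 sT) gq.
pose h s := M (s / 2) * fine (L s) + c2 (s / 2) `^ gamma^-1.
have h0 s : 0 < s -> s <= T -> 0 <= h s.
  by move=> s0 sT; rewrite addr_ge0 ?powR_ge0// mulr_ge0 ?Mfun_ge0 ?fine_ge0.
have hN s : 0 < s -> s <= t ->
    ((h s)%:E / (M s `^ theta^-1 * fine (E s) `^ (theta_l / theta))%:E <= Nt)%E.
  move=> s0 st; have sT := le_trans st tT.
  apply: ereal_sup_ubound; exists s; first by rewrite /= in_itv/= s0.
  rewrite /h EFinD EFinM fineK ?Lfin//.
  by rewrite EFinM -[(fine (E s) `^ _)%:E]poweR_EFin fineK ?Efin.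
have Nt0 : (0 <= Nt)%E.
  apply: le_trans (hN t t0 (lexx t)); rewrite mule_ge0 ?lee_fin ?h0//.
  by rewrite inve_ge0 lee_fin mulr_ge0 ?powR_ge0.
pose n := fine Nt.
have NtE : Nt = n%:E by rewrite fineK// ge0_fin_numE.
have n0 : 0 <= n by rewrite fine_ge0.
pose e := fine (E t).
have eE : E t = e%:E by rewrite fineK// Efin.
have e0 : 0 < e by rewrite -lte_fin -eE.
(* E is frozen at the final time t, so that [a] does not depend on s; monotonicity of E gives E(s/2)
   <= E(t). *)
pose a := e `^ theta_l.
have a0 : 0 < a by rewrite powR_gt0.
pose v s := fine (nrm mu r (u s)).
have vE s : 0 < s -> s <= T -> nrm mu r (u s) = (v s)%:E.
  by move=> s0 sT; rewrite fineK// ge0_fin_numE ?nrm_ge0//; exact/ur/sI.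
have v0 s : 0 <= v s by rewrite fine_ge0// nrm_ge0.
pose w s := v s `^ gamma^-1.
have [B BP] : exists B : R, forall t, 0 < t -> t <= T -> (nrm mu q%:E (u t) <= B%:E)%E.
  by apply: (truncation_decay_uniform_bound l0 lq qr om0 mgl gl mu_ _ uC decay); exact: ul.
have halfT s : 0 < s -> s <= T -> 0 < s / 2 /\ s / 2 <= T by move=> ? ?; split; lra.
pose A s := fine (nrm mu q%:E (u (s / 2))) + fine (L s).
have qfin s : 0 < s -> s <= T -> nrm mu q%:E (u s) \is a fin_num.
  by move=> s0 sT; rewrite ge0_fin_numE ?nrm_ge0//; exact: le_lt_trans (BP _ s0 sT) (ltry _).
have A0 s : 0 <= A s by rewrite addr_ge0 ?fine_ge0 ?nrm_ge0.
have wA s : 0 < s -> s <= T -> w s <= M (s / 2) * A s + c2 (s / 2) `^ gamma^-1.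
  move=> s0 sT; have [s20 s2T] := halfT s s0 sT.
  have AE : (nrm mu q%:E (u (s / 2)%R) + L1Lp mu q%:E g (s / 2)%R s = (A s)%:E)%E.
    by rewrite /A EFinD !fineK ?Lfin ?qfin.
  have := smooth s s0 sT; rewrite AE vE// !poweR_EFin -!EFinM -EFin_max lee_fin => sm.
  have kE : (s / 2)^-1 = 2 / s by rewrite invf_div.
  rewrite /w /M /Mfun kE.
  have c1s := ltW (c10 _ (sI _ s20 s2T)); have c2s := c20 _ (sI _ s20 s2T).
  apply: (smoothing_root (gammas := gammas)) => //.
  by rewrite addr_ge0// divr_ge0// ltW.
have key : w t <= ((2 `^ (alpha / gamma)) `^ theta^-1 + n `^ theta) `^ theta^-1
    * (M t * a) `^ theta^-1.
  have sT s : 0 < s <= t -> s <= T by move=> /andP[_ st]; exact: le_trans tT.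
  pose G := fine (L1Lp mu q%:E g 0 T).
  pose kap : R := 2 `^ (alpha / gamma).
  (* The a priori constant: w(s) <= M(s/2) (|B| + G + 1), where the 1 absorbs c2(s/2)^(1/gamma) <=
     M(s/2). Then M(s/2) <= kap M(s), and M(s) <= M(s)^(1/theta) / m0^(1/theta - 1) since M(s) >= m0
     and 1/theta >= 1. *)
  apply: (@scaled_halving_bound _ kap n a theta t
     (kap * (`|B| + G + 1) * (m0 `^ (theta^-1 - 1))^-1) M w h) => //.
  - by rewrite th0 th1.
  - exact: powR_ge0.
  - by move=> s /[dup] /sT ? /andP[s0 _]; exact: M0.
  - by move=> s /[dup] /sT {}sT /andP[s0 _]; exact: (Mfun_half_le c1h c2h c10 c20 om0 al0 g0 s0 sT).
  - by move=> s _; exact: powR_ge0.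
  - move=> s /[dup] /sT {}sT /andP[s0 _]; have [s20 s2T] := halfT s s0 sT.
    apply: le_trans (wA _ s0 sT) _.
    have c2M : c2 (s / 2) `^ gamma^-1 <= M (s / 2) by rewrite /M /Mfun le_max lexx orbT.
    have AB : A s <= `|B| + G.
      apply: lerD; rewrite -lee_fin fineK ?qfin ?Lfin//.
        by apply: le_trans (BP _ s20 s2T) _; rewrite lee_fin ler_norm.
      by rewrite /G fineK ?LT// ge0_fin_numE// integral_ge0// => *; exact: nrm_ge0.
    have AB0 : 0 <= `|B| + G + 1 by rewrite addr_ge0// (le_trans (A0 s)).
    apply: (@le_trans _ _ (M (s / 2) * (`|B| + G + 1))).
      by rewrite [leRHS]mulrDr mulr1 lerD// ler_wpM2l// Mfun_ge0.
    apply: (@le_trans _ _ (kap * M s * (`|B| + G + 1))).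
      by rewrite ler_wpM2r//; exact: (Mfun_half_le c1h c2h c10 c20 om0 al0 g0 s0 sT).
    have -> : kap * M s * (`|B| + G + 1) = kap * (`|B| + G + 1) * M s by ring.
    rewrite -[leRHS]mulrA ler_wpM2l ?mulr_ge0 ?powR_ge0//.
    rewrite mulrC ler_pdivlMr ?powR_gt0//.
    have -> : M s `^ theta^-1 = M s * M s `^ (theta^-1 - 1).
      by rewrite mulr_powRB1 ?Mfun_ge0 ?invr_gt0.
    rewrite ler_wpM2l ?Mfun_ge0//.
    apply: powR_le2r; [|exact: ltW|exact: Mm0].
    by rewrite subr_ge0 invf_ge1// ltW.
  (* Interpolation at time s/2: the L^l factor is bounded by [a], and the L^r factor is
     w(s/2)^(1-theta) by [thE]. *)
  - move=> s /[dup] /sT {}sT /andP[s0 st]; have [s20 s2T] := halfT s s0 sT.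
    apply: le_trans (wA _ s0 sT) _; rewrite /A /h mulrDr -!addrA lerD2r.
    rewrite -mulrA ler_wpM2l ?Mfun_ge0//.
    rewrite -lee_fin fineK ?qfin//.
    apply: le_trans (nrm_interpolation _ l0 lq qr _) _; [exact/mu_/sI | exact/ur/sI |].
    rewrite EFinM; apply: lee_pmul; rewrite ?poweR_ge0//.
      rewrite /a -poweR_EFin -eE; apply: poweR_le2r; rewrite ?nrm_ge0 ?(ltW tl0)//.
      by apply: le_trans (uE _ s20 s2T) _; apply: Emono; lra.
    rewrite vE// poweR_EFin lee_fin thE /w -powRrM mulrA mulVf// mul1r.
    by [].
  - move=> s /[dup] /sT {}sT /andP[s0 st].
    have := hN _ s0 st; rewrite NtE => /ediv_le_mul.
    move=> /(_ (h0 _ s0 sT) (mulr_ge0 (powR_ge0 _ _) (powR_ge0 _ _)) n0) H.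
    apply: le_trans H _; rewrite ler_wpM2l// powRM ?Mfun_ge0 ?(ltW a0)//.
    rewrite ler_wpM2l ?powR_ge0// /a -powRrM.
    apply: powR_le2r; [by rewrite divr_ge0// ltW | exact: fine_ge0 |].
    by rewrite -lee_fin -eE fineK ?Efin// Emono.
rewrite vE// eE poweR_EFin.
have KE : (2 `^ (alpha / gamma)) `^ theta^-1 = K.
  by rewrite -powRrM /K invfM mulrA.
have vt : v t <= (K + n `^ theta) `^ (gamma / theta) * M t `^ (gamma / theta)
    * e `^ (theta_l * gamma / theta).
  (* Raising the comparison to the power gamma returns from [w] to the norm itself. *)
  rewrite -(powRVK gn (v0 t)) -/(w t).
  apply: le_trans (powR_le2r (ltW g0) (powR_ge0 _ _) key) _.
  rewrite KE !powRM ?mulr_ge0 ?powR_ge0 ?Mfun_ge0 ?(ltW a0)//.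
  rewrite /a -!powRrM !(mulrC _ gamma).
  rewrite [gamma * theta_l]mulrC !mulrA le_eqVlt; apply/orP; left; apply/eqP.
  by congr (_ * _ `^ _); ring.
have nS : ((K + n `^ theta)%:E <= K%:E + S)%E.
  by rewrite EFinD leeD2l// -poweR_EFin -NtE.
apply: (@le_trans _ _ ((K + n `^ theta) `^ (gamma / theta) * M t `^ (gamma / theta)
    * e `^ (theta_l * gamma / theta))%:E); first by rewrite lee_fin.
rewrite !EFinM; apply: lee_wpmul2r; first by rewrite lee_fin powR_ge0.
apply: lee_wpmul2r; first by rewrite lee_fin powR_ge0.
apply: (@le_trans _ _ ((K%:E + S) `^ (gamma / theta))%E).
  rewrite -poweR_EFin; apply: poweR_le2r => //; first exact: ltW.
  by rewrite lee_fin addr_ge0 ?powR_ge0// ltW.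
apply: lee_pemull; first exact: poweR_ge0.
by rewrite lee_fin -[leLHS](powRr0 (2 : R)) ler_powR// ?ler1n// ltW.
Qed.
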